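(* Let $\mathcal{E}$ be a ground ES and let $>$ be a reduction order that is total on $\mathcal{E}$-equivalent ground terms, i.e. for all ground terms $s,t$ with $s\leftrightarrow_{\mathcal{E}}^*t$ we have $s>t$, $t>s$, or $s=t$. Then every maximal $\mathsf{KB_g}$ run $(\mathcal{E},\varnothing)\vdash_{\mathsf g}(\mathcal{E}_1,\mathcal{R}_1)\vdash_{\mathsf g}\cdots\vdash_{\mathsf g}(\mathcal{E}_n,\mathcal{R}_n)$ produces an equivalent canonical presentation of $\mathcal{E}$: $\mathcal{E}_n=\varnothing$, the TRS $\mathcal{R}_n$ is canonical, and $\leftrightarrow_{\mathcal{R}_n}^*\,=\,\leftrightarrow_{\mathcal{E}}^*$.
   Context: An ES is a set of pairs of terms $s\approx t$; it is ground if all its terms are ground (variable-free). For a set $X$ of pairs of terms, $\to_X$ is its closure under contexts and substitutions and $\leftrightarrow_X^*$ the induced conversion relation; $\mathrm{NF}(X)$ is the set of $\to_X$-normal forms. A reduction order is a well-founded strict order on terms closed under contexts and substitutions. A TRS $\mathcal{R}$ is reduced if for every $\ell\to r\in\mathcal{R}$ we have $\ell\in\mathrm{NF}(\mathcal{R}\setminus\{\ell\to r\})$ and $r\in\mathrm{NF}(\mathcal{R})$; it is canonical if it is reduced, terminating, and confluent. Inference system $\mathsf{KB_g}$ of ground completion (for the fixed reduction order $>$; $\uplus$ is disjoint union): $(\mathcal{E},\mathcal{R})\vdash_{\mathsf g}(\mathcal{E}',\mathcal{R}')$ if it is an instance of one of - orient: $(\mathcal{E}\uplus\{s\approx t\},\mathcal{R})\vdash(\mathcal{E},\mathcal{R}\cup\{s\to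 t\})$ if $s>t$, and $(\mathcal{E}\uplus\{s\approx t\},\mathcal{R})\vdash(\mathcal{E},\mathcal{R}\cup\{t\to s\})$ if $t>s$; - delete: $(\mathcal{E}\uplus\{s\approx s\},\mathcal{R})\vdash(\mathcal{E},\mathcal{R})$; - compose: $(\mathcal{E},\mathcal{R}\uplus\{s\to t\})\vdash(\mathcal{E},\mathcal{R}\cup\{s\to u\})$ if $t\to_{\mathcal{R}}u$; - simplify: $(\mathcal{E}\uplus\{s\approx t\},\mathcal{R})\vdash(\mathcal{E}\cup\{u\approx t\},\mathcal{R})$ if $s\to_{\mathcal{R}}u$, and $(\mathcal{E}\uplus\{s\approx t\},\mathcal{R})\vdash(\mathcal{E}\cup\{s\approx u\},\mathcal{R})$ if $t\to_{\mathcal{R}}u$; - collapse: $(\mathcal{E},\mathcal{R}\uplus\{t\to s\})\vdash(\mathcal{E}\cup\{u\approx s\},\mathcal{R})$ if $t\to_{\mathcal{R}}u$. A maximal run is a finite sequence of $\vdash_{\mathsf g}$ steps starting from $(\mathcal{E},\varnothing)$ such that no inference rule is applicable to its last pair. *)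

(* Defs.v *)
From Stdlib Require Import Relation_Operators RelationClasses.
From mathcomp Require Import all_boot.
From mathcomp Require Import classical_sets.

Set Implicit Arguments.
Unset Strict Implicit.
Unset Printing Implicit Defensive.

Local Open Scope classical_set_scope.

Section Terms.
Variables (F : Type) (ar : F -> nat) (V : Type).

Inductive term : Type :=
| Var (x : V)
| App (f : F) (ts : 'I_(ar f) -> term).

Fixpoint ground (t : term) : Prop :=
  match t with
  | Var _ => False
  | App _ ts => forall i, ground (ts i)
  end.

Fixpoint subst (sigma : V -> term) (t : term) : term :=
  match t with
  | Var x => sigma x
  | App f ts => App (fun i => subst sigma (ts i))
  end.

(* In [CApp i ts C] the subcontext [C] sits at argument position [i];
   the value [ts i] is irrelevant. *)
Inductive ctx : Type :=
| Hole
| CApp (f : F) (i : 'I_(ar f)) (ts : 'I_(ar f) -> term) (C : ctx).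

Fixpoint fill (C : ctx) (t : term) : term :=
  match C with
  | Hole => t
  | CApp f i ts D => App (fun j => if j == i then fill D t else ts j)
  end.

(* Both ESs and TRSs: [(s, t)] stands for s ≈ t, resp. s → t. *)
Definition system := set (term * term).

Definition ground_system (X : system) : Prop :=
  forall s t, X (s, t) -> ground s /\ ground t.

Definition rewrite (X : system) (s t : term) : Prop :=
  exists l r C sigma,
    [/\ X (l, r), s = fill C (subst sigma l) & t = fill C (subst sigma r)].

Definition rewrites (X : system) : term -> term -> Prop :=
  clos_refl_trans _ (rewrite X).

Definition conversion (X : system) : term -> term -> Prop :=
  clos_refl_sym_trans _ (rewrite X).

Definition NF (X : system) : set term := [set t | ~ exists u, rewrite X t u].

Definition terminating (X : system) : Prop :=
  well_founded (fun t s => rewrite X s t).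

Definition confluent (X : system) : Prop :=
  forall s t u, rewrites X s t -> rewrites X s u ->
    exists v, rewrites X t v /\ rewrites X u v.

Definition reduced (R : system) : Prop :=
  forall l r, R (l, r) -> NF (R `\ (l, r)) l /\ NF R r.

Definition canonical (R : system) : Prop :=
  [/\ reduced R, terminating R & confluent R].

(* [gt s t] means s > t. *)
Record reduction_order (gt : term -> term -> Prop) : Prop := {
  ro_strict : StrictOrder gt;
  ro_wf : well_founded (fun t s => gt s t);
  ro_ctx : forall C s t, gt s t -> gt (fill C s) (fill C t);
  ro_subst : forall sigma s t, gt s t -> gt (subst sigma s) (subst sigma t)
}.

Definition total_on_equivalent (E : system) (gt : term -> term -> Prop) : Prop :=
  forall s t, ground s -> ground t -> conversion E s t ->
    [\/ gt s t, gt t s | s = t].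

(* A disjoint union X ⊎ {p} is rendered as [X `|` [set p]] together with
   the premise [~ X p]. *)
Inductive KBg (gt : term -> term -> Prop) :
    system * system -> system * system -> Prop :=
| orient_l (E R : system) s t : ~ E (s, t) -> gt s t ->
    KBg gt (E `|` [set (s, t)], R) (E, R `|` [set (s, t)])
| orient_r (E R : system) s t : ~ E (s, t) -> gt t s ->
    KBg gt (E `|` [set (s, t)], R) (E, R `|` [set (t, s)])
| delete (E R : system) s : ~ E (s, s) ->
    KBg gt (E `|` [set (s, s)], R) (E, R)
| compose (E R : system) s t u : ~ R (s, t) -> rewrite R t u ->
    KBg gt (E, R `|` [set (s, t)]) (E, R `|` [set (s, u)])
| simplify_l (E R : system) s t u : ~ E (s, t) -> rewrite R s u ->
    KBg gt (E `|` [set (s, t)], R) (E `|` [set (u, t)], R)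
| simplify_r (E R : system) s t u : ~ E (s, t) -> rewrite R t u ->
    KBg gt (E `|` [set (s, t)], R) (E `|` [set (s, u)], R)
| collapse (E R : system) t s u : ~ R (t, s) -> rewrite R t u ->
    KBg gt (E, R `|` [set (t, s)]) (E `|` [set (u, s)], R).

(* The run consists of the pairs [(Es i, Rs i)] for [i <= n]; the values
   beyond [n] are irrelevant. *)
Definition maximal_run (gt : term -> term -> Prop) (E : system) (n : nat)
    (Es Rs : nat -> system) : Prop :=
  [/\ Es 0 = E, Rs 0 = set0,
      forall i, i < n -> KBg gt (Es i, Rs i) (Es i.+1, Rs i.+1) &
      ~ exists ER, KBg gt (Es n, Rs n) ER].

End Terms.

(* Main.v *)
(** Every step preserves groundness, the inclusion of the rules in [>] and the
    conversion relation of [E ∪ R].  An equation left over at the end of a run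
    is ground and E-convertible, so totality of [>] makes orient or delete
    applicable; hence the final [E] is empty.  If the final rules were not
    reduced, collapse or compose would apply: in the compose case a rule cannot
    rewrite its own right-hand side, since [l > C[l]] is impossible for a
    well-founded order.  Finally, in a reduced ground system two redexes of a
    term are equal or parallel, so the system is locally confluent, and
    Newman's lemma applies. *)

Require Import Defs.
From Stdlib Require Import Relation_Operators RelationClasses.
From mathcomp Require Import all_boot.
From mathcomp Require Import classical_sets.
From mathcomp Require Import boolp(funext, propext, contrapT).

Section GroundCompletion.

Set Implicit Arguments.
Unset Strict Implicit.
Unset Printing Implicit Defensive.

Local Open Scope classical_set_scope.

Variables (F : Type) (ar : F -> nat) (V : Type).
Implicit Types (s t u l r : term ar V) (C : ctx ar V) (X Y : system ar V).
Implicit Types (gt : term ar V -> term ar V -> Prop).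

(** * Ground terms, term size, and rewriting under contexts *)

Lemma subst_Var t : subst (@Var F ar V) t = t.
Proof. by elim: t => //= f ts IH; congr App; apply/funext. Qed.

Lemma subst_ground sigma t : ground t -> subst sigma t = t.
Proof.
elim: t => //= f ts IH gts; congr App.
by apply/funext => i; apply: IH.
Qed.

Lemma ground_fill_replace C l r :
  ground (fill C l) -> ground r -> ground (fill C r).
Proof.
elim: C => //= f i ts C IH g gr j; move: (g j).
by case: eqP => // _ gl; apply: IH.
Qed.

(** Counts function symbols. It serves to show that the left-hand side of a rule cannot occur inside
    one of its own arguments. *)
Fixpoint tsize t : nat :=
  if t is App f ts then (\sum_(i < ar f) tsize (ts i)).+1 else 0.

Lemma tsize_arg f (ts : 'I_(ar f) -> term ar V) i : tsize (ts i) < tsize (App ts).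
Proof. by rewrite /= ltnS (bigD1 i) //= leq_addr. Qed.

Lemma tsize_fill C t : tsize t <= tsize (fill C t).
Proof.
elim: C => // f i ts C IH; apply: leq_trans IH _; apply: ltnW.
have := tsize_arg (fun j => if j == i then fill C t else ts j) i.
by rewrite eqxx.
Qed.

Lemma rewrite_rule X l r : X (l, r) -> rewrite X l r.
Proof. by exists l, r, (Hole _ _), (@Var F ar V); rewrite /= !subst_Var. Qed.

Lemma rewrite_mono X Y : X `<=` Y -> forall s t, rewrite X s t -> rewrite Y s t.
Proof.
move=> XY s t [l [r [C [sigma [Xlr -> ->]]]]].
by exists l, r, C, sigma; split=> //; apply: XY.
Qed.

(** Substitutions fix ground rules, so contexts alone generate the rewrite relation. *)
Lemma rewrite_ground X s t : ground_system X -> rewrite X s t ->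
  exists l r C, [/\ X (l, r), s = fill C l & t = fill C r].
Proof.
move=> gX [l [r [C [sigma [Xlr -> ->]]]]]; have [gl gr] := gX _ _ Xlr.
by exists l, r, C; rewrite !subst_ground.
Qed.

Lemma ground_rewrite X s t : ground_system X -> ground s -> rewrite X s t ->
  ground t.
Proof.
move=> gX gs /(rewrite_ground gX)[l [r [C [Xlr es ->]]]].
have [_ gr] := gX _ _ Xlr.
by apply: (@ground_fill_replace C l) gr; rewrite -es.
Qed.

Lemma rewrite_arg X f i (ts : 'I_(ar f) -> term ar V) s t : rewrite X s t ->
  rewrite X (fill (CApp i ts (Hole _ _)) s) (fill (CApp i ts (Hole _ _)) t).
Proof.
move=> [l [r [C [sigma [Xlr -> ->]]]]].
by exists l, r, (CApp i ts C), sigma.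
Qed.

Lemma rewrites_arg X f i (ts : 'I_(ar f) -> term ar V) s t : rewrites X s t ->
  rewrites X (fill (CApp i ts (Hole _ _)) s) (fill (CApp i ts (Hole _ _)) t).
Proof.
elim=> [a b ab|a|a b c _ IH1 _ IH2]; first exact/rt_step/rewrite_arg.
- exact: rt_refl.
- exact: rt_trans IH1 IH2.
Qed.

Lemma conversion_arg X f i (ts : 'I_(ar f) -> term ar V) s t : conversion X s t ->
  conversion X (fill (CApp i ts (Hole _ _)) s) (fill (CApp i ts (Hole _ _)) t).
Proof.
elim=> [a b ab|a|a b _ IH|a b c _ IH1 _ IH2]; first exact/rst_step/rewrite_arg.
- exact: rst_refl.
- exact: rst_sym.
- exact: rst_trans IH1 IH2.
Qed.

Lemma conversion_fill X C s t : conversion X s t ->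
  conversion X (fill C s) (fill C t).
Proof. by elim: C => //= f i ts C IH /IH; apply: conversion_arg. Qed.

(** Reduces comparing two conversions to checking single pairs of [X]. As [X] is ground, only
    closure under contexts has to be transported. *)
Lemma conversion_ground_sub X Y : ground_system X ->
  (forall l r, X (l, r) -> conversion Y l r) ->
  forall s t, conversion X s t -> conversion Y s t.
Proof.
move=> gX XY s t; elim=> [a b|a|a b _ IH|a b c _ IH1 _ IH2].
- move=> /(rewrite_ground gX)[l [r [C [Xlr -> ->]]]].
  exact/conversion_fill/XY.
- exact: rst_refl.
- exact: rst_sym.
- exact: rst_trans IH1 IH2.
Qed.

Lemma conversion_rule X l r : X (l, r) -> conversion X l r.
Proof. by move=> /rewrite_rule; apply: rst_step. Qed.

Lemma conversion_rewrite X Y s t : X `<=` Y -> rewrite X s t -> conversion Y s t.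
Proof. by move=> XY /(rewrite_mono XY); apply: rst_step. Qed.

(* Stated by matching on [s], which avoids inverting equations between
   dependently typed applications. *)
Lemma rewrite_root_or_arg X s t : ground_system X -> rewrite X s t ->
  X (s, t) \/
  match s with
  | Var _ => False
  | App f ts => exists i u,
      rewrite X (ts i) u /\ t = fill (CApp i ts (Hole _ _)) u
  end.
Proof.
move=> gX /(rewrite_ground gX)[l [r [C [Xlr -> ->]]]].
case: C => [|f i ts C] /=; [by left|right].
have [gl gr] := gX _ _ Xlr.
exists i, (fill C r); split.
  by rewrite eqxx; exists l, r, C, (@Var F ar V); rewrite !subst_Var.
by congr App; apply/funext => j; case: eqP.
Qed.

(** * Local confluence of reduced ground systems *)

Definition joinable X t u := exists v, rewrites X t v /\ rewrites X u v.

(** A redex in an argument would make the whole left-hand side reducible. The rule used there is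
    another one, because its left-hand side is no larger than the argument and so smaller than
    [App ts]. *)
Lemma reduced_lhs_arg_NF X f (ts : 'I_(ar f) -> term ar V) r i :
  ground_system X -> reduced X -> X (App ts, r) -> NF X (ts i).
Proof.
move=> gX redX Xr [u /(rewrite_ground gX)[l2 [r2 [C [X2 e _]]]]].
have [nf _] := redX _ _ Xr; apply: nf.
exists (fill (CApp i ts C) r2).
exists l2, r2, (CApp i ts C), (@Var F ar V); rewrite !subst_Var; split=> //.
  split=> // -[el _]; have := tsize_arg ts i.
  by rewrite e el ltnNge tsize_fill.
rewrite /= -e; congr App; apply/funext => j.
by case: eqP => // ->.
Qed.

(** Otherwise the second rule survives the removal of the first and rewrites [l] at the root. *)
Lemma reduced_lhs_inj X l r1 r2 : reduced X -> X (l, r1) -> X (l, r2) -> r1 = r2.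
Proof.
move=> redX X1 X2; have [nf _] := redX _ _ X1.
apply: contrapT => ne; apply: nf; exists r2; apply: rewrite_rule.
by split=> // -[/esym].
Qed.

Lemma reduced_locally_confluent X s t u : ground_system X -> reduced X ->
  rewrite X s t -> rewrite X s u -> joinable X t u.
Proof.
move=> gX redX; elim: s t u => [x|f ts IH] t u
  /(rewrite_root_or_arg gX)[Xt|ht] /(rewrite_root_or_arg gX)[Xu|hu] //.
- by rewrite (reduced_lhs_inj redX Xt Xu); exists u; split; apply: rt_refl.
- by rewrite (reduced_lhs_inj redX Xt Xu); exists u; split; apply: rt_refl.
- have [i [v [hv _]]] := hu.
  by case: (reduced_lhs_arg_NF (i := i) gX redX Xt); exists v.
- have [i [v [hv _]]] := ht.
  by case: (reduced_lhs_arg_NF (i := i) gX redX Xu); exists v.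
have [[i [v [hv ->]]] [j [w [hw ->]]]] := (ht, hu).
have [eij|nij] := eqVneq i j.
  rewrite -eij in hw *; have [z [vz wz]] := IH _ _ _ hv hw.
  by exists (fill (CApp i ts (Hole _ _)) z); split; apply: rewrites_arg.
(* Steps in distinct arguments commute: the common reduct has [v] at [i] and [w] at [j]. The
   arguments after one step alone are [ts_v] and [ts_w], so each remaining step is again a step in a
   single argument. *)
pose ts_v k := if k == i then v else ts k.
pose ts_w k := if k == j then w else ts k.
exists (fill (CApp j ts_v (Hole _ _)) w); split; apply: rt_step.
  have -> : fill (CApp i ts (Hole _ _)) v = fill (CApp j ts_v (Hole _ _)) (ts j).
    congr App; apply/funext => k; rewrite /ts_v.
    by have [->|//] := eqVneq k j; rewrite eq_sym (negbTE nij).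
  exact: rewrite_arg.
have -> : fill (CApp j ts (Hole _ _)) w = fill (CApp i ts_w (Hole _ _)) (ts i).
  congr App; apply/funext => k; rewrite /ts_w.
  by have [->|//] := eqVneq k i; rewrite (negbTE nij).
have -> : fill (CApp j ts_v (Hole _ _)) w = fill (CApp i ts_w (Hole _ _)) v.
  congr App; apply/funext => k; rewrite /ts_w /ts_v.
  by have [->|//] := eqVneq k i; rewrite (negbTE nij).
exact: rewrite_arg.
Qed.

(** * Newman's lemma *)

Lemma rewrites_inv X s t : rewrites X s t ->
  s = t \/ exists2 u, rewrite X s u & rewrites X u t.
Proof.
elim=> [a b ab|a|a b c _ IH1 bc IH2]; [right|by left|].
  by exists b => //; apply: rt_refl.
case: IH1 => [->//|[u au ub]]; right; exists u => //.
exact: rt_trans ub bc.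
Qed.

Lemma newman X : terminating X ->
  (forall s t u, rewrite X s t -> rewrite X s u -> joinable X t u) ->
  confluent X.
Proof.
move=> wfX lc s; elim/(well_founded_ind wfX): s => s IH t u st su.
case: (rewrites_inv st) => [<-|[t1 st1 t1t]].
  by exists u; split=> //; apply: rt_refl.
case: (rewrites_inv su) => [<-|[u1 su1 u1u]].
  by exists t; split=> //; apply: rt_refl.
have [v [t1v u1v]] := lc _ _ _ st1 su1.
(* The induction hypothesis at [t1] joins [t] with [v]; the one at [u1] then joins the resulting [w]
   with [u]. *)
have [w [tw vw]] := IH _ st1 _ _ t1t t1v.
have [z [wz uz]] := IH _ su1 _ _ (rt_trans _ _ _ _ _ u1v vw) u1u.
by exists z; split=> //; apply: rt_trans tw wz.
Qed.

(** * Reduction orders *)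

Lemma reduction_order_rewrite gt X : reduction_order gt ->
  (forall l r, X (l, r) -> gt l r) -> forall s t, rewrite X s t -> gt s t.
Proof.
move=> ro Xgt s t [l [r [C [sigma [Xlr -> ->]]]]].
exact/(ro_ctx ro)/(ro_subst ro)/Xgt.
Qed.

Lemma reduction_order_terminating gt X : reduction_order gt ->
  (forall l r, X (l, r) -> gt l r) -> terminating X.
Proof.
move=> ro Xgt s; elim/(well_founded_ind (ro_wf ro)): s => s IH.
by constructor=> t /(reduction_order_rewrite ro Xgt); apply: IH.
Qed.

(** Closure under contexts would repeat the inequality at [fill C t], hence an infinite descent t >
    C[t] > C[C[t]] > ... *)
Lemma reduction_order_fill gt C t : reduction_order gt -> ~ gt t (fill C t).
Proof.
move=> ro; elim/(well_founded_ind (ro_wf ro)): t => t IH h.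
exact: IH h (ro_ctx ro C h).
Qed.

(** Brings a set into the disjoint-union form that the inference rules match on. *)
Lemma setU_singletonK (T : Type) (A : set T) a : A a ->
  A = (A `\ a) `|` [set a].
Proof. by move=> Aa; rewrite setUC setD1K. Qed.

(** * Invariants of a run *)

Definition ground_oriented gt (p : system ar V * system ar V) : Prop :=
  [/\ ground_system p.1, ground_system p.2 & forall l r, p.2 (l, r) -> gt l r].

Lemma ground_system_add X s t :
  ground_system (X `|` [set (s, t)]) = (ground_system X /\ ground s /\ ground t).
Proof.
apply/propext; split=> [g|[g gst] l r [/g//|[-> ->]//]].
by split=> [l r Xlr|]; apply: g; [left|right].
Qed.

Lemma KBg_ground_oriented gt p q : reduction_order gt -> KBg gt p q ->
  ground_oriented gt p -> ground_oriented gt q.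
Proof.
move=> ro; have tr := @StrictOrder_Transitive _ _ (ro_strict ro).
rewrite /ground_oriented.
case=> [E R s t _ st|E R s t _ ts|E R s _|E R s t u _ tu|E R s t u _ su
  |E R s t u _ tu|E R t s u _ tu] /=;
  rewrite !ground_system_add => -[gE gR oR].
- case: gE => gE [gs gt']; split=> // l r [/oR//|[-> ->]//].
- case: gE => gE [gs gt']; split=> // l r [/oR//|[-> ->]//].
- by case: gE.
- case: gR => gR [gs gt']; have gu := ground_rewrite gR gt' tu.
  split=> // l r [Rlr|[-> ->]]; first by apply: oR; left.
  (* The composed rule is oriented because s > t > u. *)
  apply: (tr _ t); first by apply: oR; right.
  by apply: reduction_order_rewrite tu => // a b Rab; apply: oR; left.
- case: gE => gE [gs gt']; have gu := ground_rewrite gR gs su.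
  by split.
- case: gE => gE [gs gt']; have gu := ground_rewrite gR gt' tu.
  by split.
- case: gR => gR [gs gt']; have gu := ground_rewrite gR gs tu.
  by split=> // l r Rlr; apply: oR; left.
Qed.

(** In compose, simplify and collapse the old and the new pair differ by one step of [R]. This [R]
    excludes the pair being replaced and is present on both sides, so the step can be undone in
    either direction. *)
Lemma KBg_conversion_sub gt p q : KBg gt p q ->
  (forall l r, (p.1 `|` p.2) (l, r) -> conversion (q.1 `|` q.2) l r) /\
  (forall l r, (q.1 `|` q.2) (l, r) -> conversion (p.1 `|` p.2) l r).
Proof.
have rule X l r : X (l, r) -> conversion X l r := @conversion_rule X l r.
have rule_sym X l r : X (l, r) -> conversion X r l.
  by move=> /rule; apply: rst_sym.
case=> [E R s t _ st|E R s t _ ts|E R s _|E R s t u _ tu|E R s t u _ su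
  |E R s t u _ tu|E R t s u _ tu] /=.
- split=> l r; first by case=> [[h|[-> ->]]|h]; apply: rule; firstorder.
  by case=> [h|[h|[-> ->]]]; apply: rule; firstorder.
- split=> l r.
    case=> [[h|[-> ->]]|h]; [by apply: rule; left| |by apply: rule; right; left].
    by apply: rule_sym; right; right.
  case=> [h|[h|[-> ->]]]; [by apply: rule; left; left|by apply: rule; right|].
  by apply: rule_sym; left; right.
- split=> l r; last by case=> h; apply: rule; [left; left|right].
  by case=> [[h|[-> ->]]|h]; [apply: rule; left|apply: rst_refl|apply: rule; right].
- have cv Y : R `<=` Y -> conversion Y t u.
    by move=> RY; apply: conversion_rewrite tu.
  split=> l r; (case=> [h|[h|[-> ->]]];
    [by apply: rule; left|by apply: rule; right; left|]).
    apply: rst_trans (rst_sym _ _ _ _ (cv _ _)); last by move=> ? ?; right; left.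
    by apply: rule; right; right.
  apply: rst_trans (cv _ _); last by move=> ? ?; right; left.
  by apply: rule; right; right.
- have cv Y : R `<=` Y -> conversion Y s u.
    by move=> RY; apply: conversion_rewrite su.
  split=> l r; (case=> [[h|[-> ->]]|h];
    [by apply: rule; left; left| |by apply: rule; right]).
    apply: rst_trans (cv _ _) _; first by move=> ? ?; right.
    by apply: rule; left; right.
  apply: rst_trans (rst_sym _ _ _ _ (cv _ _)) _; first by move=> ? ?; right.
  by apply: rule; left; right.
- have cv Y : R `<=` Y -> conversion Y t u.
    by move=> RY; apply: conversion_rewrite tu.
  split=> l r; (case=> [[h|[-> ->]]|h];
    [by apply: rule; left; left| |by apply: rule; right]).
    apply: rst_trans (rst_sym _ _ _ _ (cv _ _)); last by move=> ? ?; right.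
    by apply: rule; left; right.
  apply: rst_trans (cv _ _); last by move=> ? ?; right.
  by apply: rule; left; right.
- have cv Y : R `<=` Y -> conversion Y t u.
    by move=> RY; apply: conversion_rewrite tu.
  split=> l r.
    case=> [h|[h|[-> ->]]]; [by apply: rule; left; left|by apply: rule; right|].
    apply: rst_trans (cv _ _) _; first by move=> ? ?; right.
    by apply: rule; left; right.
  case=> [[h|[-> ->]]|h]; [by apply: rule; left| |by apply: rule; right; left].
  apply: rst_trans (rst_sym _ _ _ _ (cv _ _)) _; first by move=> ? ?; right; left.
  by apply: rule; right; right.
Qed.

Lemma ground_oriented_setU gt p : ground_oriented gt p ->
  ground_system (p.1 `|` p.2).
Proof. by case=> gE gR _ s t [/gE|/gR]. Qed.

Lemma KBg_conversion gt p q : reduction_order gt -> KBg gt p q ->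
  ground_oriented gt p ->
  forall s t, conversion (p.1 `|` p.2) s t <-> conversion (q.1 `|` q.2) s t.
Proof.
move=> ro pq gop s t; have goq := KBg_ground_oriented ro pq gop.
have [pq_sub qp_sub] := KBg_conversion_sub pq.
by split; apply: conversion_ground_sub => //; apply: ground_oriented_setU;
  [exact: gop|exact: goq].
Qed.

Lemma KBg_run_invariant gt E n (Es Rs : nat -> system ar V) :
  ground_system E -> reduction_order gt ->
  Es 0 = E -> Rs 0 = set0 ->
  (forall i, i < n -> KBg gt (Es i, Rs i) (Es i.+1, Rs i.+1)) ->
  ground_oriented gt (Es n, Rs n) /\
  forall s t, conversion (Es n `|` Rs n) s t <-> conversion E s t.
Proof.
move=> gE ro E0 R0; elim: n => [|n IH] steps.
  by rewrite E0 R0 setU0; split=> //; split.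
have [go cv] := IH (fun i lin => steps i (ltnW lin)).
have step := steps n (ltnSn n).
split=> [|s t]; first exact: KBg_ground_oriented step go.
by rewrite -cv; have /= -> := KBg_conversion ro step go s t.
Qed.

(** * Pairs to which no inference rule applies *)

Lemma KBg_stuck_equations gt E0 E R : total_on_equivalent E0 gt ->
  ground_system E -> (forall s t, E (s, t) -> conversion E0 s t) ->
  ~ (exists q, KBg gt (E, R) q) -> E = set0.
Proof.
move=> tot gE cv stuck; rewrite -subset0 => -[s t] Est; apply: stuck.
have [gs gt'] := gE _ _ Est.
rewrite (setU_singletonK Est).
have nE : ~ (E `\ (s, t)) (s, t) by case=> _; apply.
case: (tot s t gs gt' (cv _ _ Est)) => [h|h|h].
- by eexists; apply: orient_l.
- by eexists; apply: orient_r.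
- by rewrite h in nE *; eexists; apply: delete.
Qed.

Lemma KBg_stuck_reduced gt E R : reduction_order gt ->
  ground_system R -> (forall l r, R (l, r) -> gt l r) ->
  ~ (exists q, KBg gt (E, R) q) -> reduced R.
Proof.
move=> ro gR oR stuck l r Rlr.
have nR : ~ (R `\ (l, r)) (l, r) by case=> _; apply.
split=> -[u hu]; apply: stuck; rewrite (setU_singletonK Rlr).
  by eexists; apply: collapse hu.
eexists; apply: (@Defs.compose _ _ _ gt E _ l r u nR).
move: hu => [l2 [r2 [C [sigma [R2 er eu]]]]].
(* The step [hu] may use all of [R], whereas compose needs one by the other rules. If the rule used
   were [(l, r)] itself, then r = C[l], against l > r. *)
exists l2, r2, C, sigma; split=> //; split=> // -[el2 _].
apply: (@reduction_order_fill gt C l ro).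
have [gl _] := gR _ _ Rlr.
by rewrite -[X in fill C X](subst_ground sigma gl) -{2}el2 -er; apply: oR.
Qed.

End GroundCompletion.

Theorem theorem5p5 (F : Type) (ar : F -> nat) (V : Type)
    (gt : term ar V -> term ar V -> Prop) (E : system ar V)
    (n : nat) (Es Rs : nat -> system ar V) :
  ground_system E ->
  reduction_order gt ->
  total_on_equivalent E gt ->
  maximal_run gt E n Es Rs ->
  [/\ Es n = set0,
      canonical (Rs n) &
      forall s t, conversion (Rs n) s t <-> conversion E s t].
Proof.
move=> gE ro tot [E0 R0 steps stuck].
have [[/= gEn gRn oRn] cv] := KBg_run_invariant gE ro E0 R0 steps.
have En0 : Es n = set0.
  apply: (KBg_stuck_equations tot gEn _ stuck) => s t Est.
  by apply/cv/conversion_rule; left.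
have red := KBg_stuck_reduced ro gRn oRn stuck.
have wfR := reduction_order_terminating ro oRn.
split=> //; last by move=> s t; rewrite -cv En0 set0U.
split=> //; apply: newman wfR _ => s t u.
exact: reduced_locally_confluent.
Qed.
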